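(* Let $F$ be a finite set with $N=|F|\ge 2$, let $P_\theta$, $\theta\in F$, be probability measures on a sample space $\mathcal X$ having densities $p_\theta$ with respect to a common sigma-finite measure $\mu$, and let $w$ be a probability measure on $F$ with $w_\theta := w\{\theta\}$. Let $T:\mathcal X\to F$ be given by $T(x):=\arg\max_{\theta\in F}\{w_\theta p_\theta(x)\}$. Then for every convex function $f:[0,\infty)\to\mathbb R$ and every probability measure $Q$ on $\mathcal X$, $$\sum_{\theta\in F} w_\theta D_f(P_\theta\|Q)\ \ge\ W f\left(\frac{1-\bar r_w}{W}\right)+(1-W) f\left(\frac{\bar r_w}{1-W}\right),\qquad W:=\int_{\mathcal X} w_{T(x)}\,dQ(x).$$ In particular, taking $w$ to be the uniform probability measure on $F$ and writing $\bar r$ for the corresponding $\bar r_w$, $$\sum_{\theta\in F} D_f(P_\theta\|Q)\ \ge\ f\big(N(1-\bar r)\big)+(N-1) f\left(\frac{N\bar r}{N-1}\right).$$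
   Context: For a convex function $f:[0,\infty)\to\mathbb R$ and probability measures $P,Q$ on $\mathcal X$, $D_f(P\|Q):=\int f\left(\frac{dP}{dQ}\right)dQ$ if $P$ is absolutely continuous with respect to $Q$, and $D_f(P\|Q):=\infty$ otherwise. The Bayes testing risk with respect to the prior $w$ is $\bar r_w:=\inf_{T'}\sum_{\theta\in F} w_\theta P_\theta\{T'\ne\theta\}$, where the infimum is over all estimators (measurable maps) $T':\mathcal X\to F$. Conventions: $0\cdot\infty=0$; the term $Wf(\cdot/W)$ is read as $0$ if $W=0$, and $(1-W)f(\cdot/(1-W))$ is read as $0$ if $W=1$. Ties in the arg max are broken in a measurable way. *)

(* Defs.v *)
From HB Require Import structures.
From mathcomp Require Import all_boot all_order all_algebra.
From mathcomp Require Import all_classical all_reals all_analysis.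

Set Implicit Arguments.
Unset Strict Implicit.
Unset Printing Implicit Defensive.

Import Order.TTheory GRing.Theory Num.Theory.
Import numFieldNormedType.Exports.

Local Open Scope classical_set_scope.
Local Open Scope ring_scope.

(* D_f(P || Q).  For finite measures [Radon_Nikodym_SigmaFinite.f P Q] is the
   library's version of dP/dQ taking values in [0, +oo[, so only the values of
   [f] on [0, +oo[ matter. *)
Definition fdiv (R : realType) (d : measure_display) (X : measurableType d)
    (f : R -> R) (P Q : probability X R) : \bar R :=
  if `[< P `<< Q >] then
    (\int[Q]_x (f (fine (Radon_Nikodym_SigmaFinite.f P Q x)))%:E)%E
  else +oo%E.

Definition is_density (R : realType) (d : measure_display)
    (X : measurableType d) (mu : {measure set X -> \bar R}) (p : X -> R)
    (P : probability X R) : Prop :=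
  [/\ measurable_fun setT p,
      forall x, 0 <= p x
    & forall A : set X, measurable A ->
        P A = (\int[mu]_(x in A) (p x)%:E)%E].

Definition is_pmf (R : realType) (F : finType) (w : F -> R) : Prop :=
  (forall t, 0 <= w t) /\ \sum_(t : F) w t = 1.

(* Measurability with respect to the discrete sigma-algebra on [F]. *)
Definition is_estimator (d : measure_display) (X : measurableType d)
    (F : finType) (T : X -> F) : Prop :=
  forall B : set F, measurable (T @^-1` B).

(* [T] selects a maximizer of [w_t p_t(x)] at every [x]; ties are broken
   arbitrarily. *)
Definition is_argmax (R : realType) (X : Type) (F : finType)
    (w : F -> R) (p : F -> X -> R) (T : X -> F) : Prop :=
  forall x t, w t * p t x <= w (T x) * p (T x) x.

Definition testing_risk (R : realType) (d : measure_display)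
    (X : measurableType d) (F : finType) (P : F -> probability X R)
    (w : F -> R) (T : X -> F) : R :=
  \sum_(t : F) w t * fine (P t [set x | T x <> t]).

Definition bayes_risk (R : realType) (d : measure_display)
    (X : measurableType d) (F : finType) (P : F -> probability X R)
    (w : F -> R) : R :=
  inf [set testing_risk P w T | T in [set T : X -> F | is_estimator T]].

(* Main.v *)
(** T is a Bayes rule, so 1 - r is the mass that the mixture over (x, theta) of
    the P_theta gives to the cell {T x = theta}, while W is the mass given to the
    same cell by Q times w. The inequality is Jensen's inequality for the
    partition of X x F into this cell and its complement. On each cell f is
    bounded below, along the density dP_theta/dQ, by an affine function whose
    averaged integral is the corresponding term of the right-hand side; summing
    affine bounds avoids any integrability assumption on f(dP_theta/dQ). *)

Require Import Defs.
From HB Require Import structures.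
From mathcomp Require Import all_boot all_order all_algebra.
From mathcomp Require Import all_classical all_reals all_analysis.
From mathcomp Require Import measurable_realfun.
From mathcomp Require Import ring lra.

Set Implicit Arguments.
Unset Strict Implicit.
Unset Printing Implicit Defensive.

Import Order.TTheory GRing.Theory Num.Theory.
Import numFieldNormedType.Exports.

Local Open Scope classical_set_scope.
Local Open Scope ring_scope.

(** * Convex functions on the half-line: chords, supporting lines, measurability *)

Section convex_halfline.
Context {R : realType}.
Variable f : R -> R.
Hypothesis cf : convex_function (`[0, +oo[%classic : set R) f.

(** The chord inequality is multiplied by [y - x], so that coinciding points are allowed. *)
Lemma convex_three_points x u y : 0 <= x -> x <= u -> u <= y ->
  (y - x) * f u <= (y - u) * f x + (u - x) * f y.
Proof.
move=> x0 xu uy; have [xy|] := ltP x y; last first.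
  move=> yx; have ux : u = x by apply/le_anti; rewrite xu (le_trans uy yx).
  have yE : y = x by apply/le_anti; rewrite yx -ux uy.
  by rewrite yE ux subrr !mul0r addr0.
have yx0 : 0 < y - x by rewrite subr_gt0.
have t0 : 0 <= (y - u) / (y - x) by rewrite divr_ge0 ?subr_ge0// ltW.
have t1 : (y - u) / (y - x) <= 1.
  by rewrite ler_pdivrMr// mul1r lerD2l lerN2.
have xD : x \in (`[0, +oo[%classic : set R) by rewrite inE/= in_itv/= x0.
have yD : y \in (`[0, +oo[%classic : set R).
  by rewrite inE/= in_itv/= (le_trans x0 (ltW xy)).
have := @cf (Itv01 t0 t1) x y xD yD.
rewrite [X in f X <= _](_ : _ = u); last first.
  change ((y - u) / (y - x) * x + (1 - (y - u) / (y - x)) * y = u).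
  by field; rewrite gt_eqF.
rewrite [leRHS](_ : _ = ((y - u) * f x + (u - x) * f y) / (y - x)); last first.
  change ((y - u) / (y - x) * f x + (1 - (y - u) / (y - x)) * f y =
    ((y - u) * f x + (u - x) * f y) / (y - x)).
  by field; rewrite gt_eqF.
by rewrite ler_pdivlMr// mulrC.
Qed.

(** The slope is the left derivative: chords ending at [u] are at most as steep as chords starting
    there, so the supremum [c] of the left slopes separates the two families. Positivity of [u]
    makes the set of left slopes nonempty. *)
Lemma convex_support u : 0 < u ->
  exists c, forall y, 0 <= y -> f u + c * (y - u) <= f y.
Proof.
move=> u0; pose E := [set (f u - f x) / (u - x) | x in [set x | 0 <= x < u]].
have E0 : E ((f u - f 0) / (u - 0)) by exists 0 => //=; rewrite lexx.
have ubE y : u < y -> ubound E ((f y - f u) / (y - u)).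
  move=> uy _ [x /= /andP[x0 xu] <-].
  rewrite ler_pdivrMr ?subr_gt0// mulrAC ler_pdivlMr ?subr_gt0//.
  by have := convex_three_points x0 (ltW xu) (ltW uy); lra.
exists (sup E) => y y0; have [yu|uy|->] := ltgtP y u; last first.
- by rewrite subrr mulr0 addr0.
- have : sup E <= (f y - f u) / (y - u).
    by apply: ge_sup; [eexists; exact: E0|exact: ubE].
  by rewrite ler_pdivlMr ?subr_gt0//; lra.
- have : (f u - f y) / (u - y) <= sup E.
    apply: ub_le_sup; last by exists y => //=; rewrite y0.
    by exists ((f (u + 1) - f u) / (u + 1 - u)); apply: ubE; rewrite ltrDl.
  by rewrite ler_pdivrMr ?subr_gt0//; lra.
Qed.

(* The sublevel sets of a convex function are intervals. *)
Lemma measurable_convex : measurable_fun (`[0, +oo[%classic : set R) f.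
Proof.
apply: (measurability _ (RGenInftyO.measurableE R)) => // _ [_ [c ->] <-].
apply: is_interval_measurable => x y [/= + fx] [/= _ fy] z /andP[xz zy].
rewrite !in_itv/= !andbT in fx fy * => x0.
have z0 := le_trans x0 xz; split => //.
have [xy|yx] := ltP x y; last first.
  by rewrite (_ : z = x)//; apply/le_anti; rewrite xz (le_trans zy yx).
have := convex_three_points x0 xz zy.
rewrite -(ltr_pM2l (_ : 0 < y - x)) ?subr_gt0// => /le_lt_trans; apply.
(* Strictness comes from [f y < c] and needs the weight [z - x] to be positive, hence the separate
   case [z = x]. *)
have [zx|xz'] := eqVneq z x.
  by rewrite zx subrr mul0r addr0 ltr_pM2l ?subr_gt0.
have {}xz' : x < z by rewrite lt_neqAle eq_sym xz' xz.
by nra.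
Qed.

End convex_halfline.

(** * Densities and lower bounds for the integral defining the divergence *)

Section integral_bounds.
Context {d : measure_display} {X : measurableType d} {R : realType}.
Implicit Types (P Q : probability X R) (g : X -> R) (A : set X).

(** The integral of [k] may be [+oo]: positive parts and negative parts are compared separately, and
    the negative part of [k] is dominated by that of the integrable [h]. *)
Lemma ae_le_integral_minorant (mu : {measure set X -> \bar R})
    (h k : X -> \bar R) : mu.-integrable setT h -> measurable_fun setT k ->
  {ae mu, forall x, (h x <= k x)%E} ->
  (\int[mu]_x h x <= \int[mu]_x k x)%E.
Proof.
move=> ih mk hk; have mh := measurable_int _ ih.
rewrite [leLHS]integralE [leRHS]integralE leeB//.
- apply: ae_ge0_le_integral => //; do ?exact: measurable_funepos.
  move: hk; apply: filterS => x hkx _.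
  by rewrite !funeposE ge_max !le_max lexx hkx orbT.
- apply: ae_ge0_le_integral => //; do ?exact: measurable_funeneg.
  move: hk; apply: filterS => x hkx _.
  by rewrite !funenegE ge_max !le_max lexx leeN2 hkx orbT.
Qed.

Lemma density_integrable (mu : {measure set X -> \bar R}) g P :
  is_density mu g P -> mu.-integrable setT (EFin \o g).
Proof.
move=> [mg g0 Pg]; apply/integrableP; split; first exact/measurable_EFinP.
under eq_integral do rewrite /= ger0_norm ?g0//.
by rewrite -Pg// probability_setT ltry.
Qed.

Lemma density_ae0 (mu : {measure set X -> \bar R}) g P A :
  is_density mu g P -> measurable A -> P A = 0%E ->
  {ae mu, forall x, A x -> g x = 0}.
Proof.
move=> [mg g0 Pg] mA PA0.
have : ae_eq mu A (EFin \o g) (cst 0%E).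
  apply/ae_eq_integral_abs => //; first exact/measurable_funTS/measurable_EFinP.
  under eq_integral do rewrite /= ger0_norm ?g0//.
  by rewrite -Pg.
by apply: filterS => x /[apply] [[]].
Qed.

(** A single real-valued density serves every [f]. *)
Lemma fdiv_density P Q : P `<< Q ->
  exists2 g, is_density Q g P &
    forall f, fdiv f P Q = (\int[Q]_x (f (g x))%:E)%E.
Proof.
move=> PQ; exists (fine \o Radon_Nikodym_SigmaFinite.f P Q); last first.
  by move=> f; rewrite /fdiv asboolT.
have mRN : measurable_fun setT (Radon_Nikodym_SigmaFinite.f P Q).
  exact: measurable_int (Radon_Nikodym_SigmaFinite.f_integrable PQ).
split.
- exact: measurableT_comp.
- by move=> x; rewrite fine_ge0// Radon_Nikodym_SigmaFinite.f_ge0.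
- move=> A mA; rewrite (Radon_Nikodym_SigmaFinite.f_integral PQ mA).
  apply: eq_integral => x _ /=.
  by rewrite fineK// Radon_Nikodym_SigmaFinite.f_fin_num.
Qed.

Lemma density_fine (mu : {measure set X -> \bar R}) g P A :
  is_density mu g P -> measurable A -> \int[mu]_(x in A) g x = fine (P A).
Proof. by move=> [_ _ Pg] mA; rewrite Pg. Qed.

(** The two affine bounds, glued along [A] and its complement, form an integrable minorant of
    [f \o g]; its integral is explicit because [g] integrates over a set to the [P]-mass of that
    set. *)
Lemma piecewise_affine_le_integral (f : R -> R) g P Q A a1 c1 a2 c2 :
  is_density Q g P -> measurable A ->
  convex_function (`[0, +oo[%classic : set R) f ->
  {ae Q, forall x, A x -> a1 + c1 * g x <= f (g x)} ->
  {ae Q, forall x, (~` A) x -> a2 + c2 * g x <= f (g x)} ->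
  ((a1 * fine (Q A) + c1 * fine (P A)
    + (a2 * fine (Q (~` A)) + c2 * fine (P (~` A))))%:E
     <= \int[Q]_x (f (g x))%:E)%E.
Proof.
move=> gP mA cf fA fAC; have [mg g0 _] := gP; have ig := density_integrable gP.
have mAC : measurable (~` A) by exact: measurableC.
pose k (a c : R) B x := ((cst a \_ B) x + c * (g \_ B) x).
have ires h B : measurable B -> Q.-integrable setT (EFin \o h) ->
    Q.-integrable setT (EFin \o (h \_ B)).
  move=> mB ih; rewrite -restrict_EFin; apply/(integrable_mkcond _ mB).
  exact: integrableS ih.
have ik1 (a : R) B : measurable B -> Q.-integrable setT (EFin \o (cst a \_ B)).
  by move=> mB; apply: ires => //; exact: (finite_measure_integrable_cst Q).
have ik2 c B : measurable B ->
    Q.-integrable setT (EFin \o (fun x => c * (g \_ B) x)).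
  move=> mB; rewrite (_ : _ \o _ = (fun x => (c%:E * ((g \_ B) x)%:E)%E))//.
  by apply: integrableZl => //; exact: ires.
have ik a c B : measurable B -> Q.-integrable setT (EFin \o k a c B).
  move=> mB; rewrite (_ : _ \o _ = ((EFin \o (cst a \_ B)) \+
    (EFin \o (fun x => (c * (g \_ B) x)%R)))%E)//.
  by apply: integrableD => //; [exact: ik1|exact: ik2].
have Ik a c B : measurable B ->
    \int[Q]_x k a c B x = a * fine (Q B) + c * fine (P B).
  move=> mB; rewrite RintegralD//; [|exact: ik1|exact: ik2].
  rewrite RintegralZl//; last exact: ires.
  by rewrite -!Rintegral_mkcond Rintegral_cst// (density_fine gP).
rewrite -!Ik// -RintegralD//; [|exact: ik|exact: ik].
have ih : Q.-integrable setT
    (EFin \o (fun x => k a1 c1 A x + k a2 c2 (~` A) x)).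
  rewrite (_ : _ \o _ = ((EFin \o k a1 c1 A) \+ (EFin \o k a2 c2 (~` A)))%E)//.
  by apply: integrableD => //; exact: ik.
rewrite /Rintegral fineK; last exact: integrable_fin_num.
apply: ae_le_integral_minorant => //.
  apply/measurable_EFinP.
  apply: (@measurable_comp _ _ _ _ _ _ (`[0, +oo[%classic : set R)) => //.
  - by move=> _ [x _ <-] /=; rewrite in_itv/= g0.
  - exact: measurable_convex.
move: fA fAC; apply: filterS2 => x fA fAC.
(* Off its set a restriction takes the value [point], which is 0 in [R], so exactly one of the two
   pieces survives at each [x]. *)
rewrite lee_fin /k !patchE in_setC (_ : point = 0 :> R)//.
have [|/negP] := boolP (x \in A); rewrite /= inE; first by move=> /fA; lra.
by move=> /fAC; lra.
Qed.

(** A supporting line of [f] at 1 has a finite integral along the density. This keeps weighted sums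
    of divergences free of [-oo] terms. *)
Lemma fdiv_gtNy (f : R -> R) P Q :
  convex_function (`[0, +oo[%classic : set R) f -> (-oo < fdiv f P Q)%E.
Proof.
move=> cf; have [PQ|nPQ] := pselect (P `<< Q); last first.
  by rewrite /fdiv asboolF.
have [g gP ->] := fdiv_density PQ; have [_ g0 _] := gP.
have [c fc] := convex_support cf (@ltr01 R).
have H : {ae Q, forall x, (f 1 - c) + c * g x <= f (g x)}.
  by apply: nearW => x; have := fc _ (g0 x); lra.
apply: lt_le_trans (ltNyr _) (@piecewise_affine_le_integral f g P Q setT
  (f 1 - c) c (f 1 - c) c gP _ cf _ _) => //; by apply: filterS H.
Qed.

End integral_bounds.

(** For a pmf [w], this is the mass that the joint law of a [w]-distributed [t] and an
    [S t]-distributed [x] gives to the set with slices [A t]. A constant family [S] gives a product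
    measure. *)
Definition weighted_mass (d : measure_display) (X : measurableType d)
    (R : realType) (F : finType) (w : F -> R) (S : F -> probability X R)
    (A : F -> set X) : R :=
  \sum_t w t * fine (S t (A t)).

(** * Jensen's inequality for a cell and its complement *)

Section two_cell_jensen.
Context {d : measure_display} {X : measurableType d} {R : realType}.
Context {F : finType}.
Variables (w : F -> R) (P : F -> probability X R) (Q : probability X R).
Hypothesis w0 : forall t, 0 <= w t.
Variable f : R -> R.
Hypothesis cf : convex_function (`[0, +oo[%classic : set R) f.

(* A convex function on [0, +oo[ may have no supporting line at 0. If
   [M / m = 0], either [M = 0] or [m = 0], and in both cases the densities vanish
   almost everywhere on the cells, where the constant [f 0] then suffices. *)
Lemma cell_support (g : F -> X -> R) (B : F -> set X) :
  (forall t, 0 < w t -> is_density Q (g t) (P t)) ->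
  (forall t, measurable (B t)) ->
  let m := weighted_mass w (fun=> Q) B in
  let M := weighted_mass w P B in
  exists a c, a * m + c * M = m * f (M / m) /\
    forall t, 0 < w t ->
      {ae Q, forall x, B t x -> a + c * g t x <= f (g t x)}.
Proof.
move=> gP mB m M.
have mt0 (S : F -> probability X R) t :
    true -> 0 <= w t * fine (S t (B t)) by rewrite mulr_ge0// fine_ge0.
have m0 : 0 <= m by apply: sumr_ge0 => t; exact: (mt0 (fun=> Q)).
have M0 : 0 <= M by apply: sumr_ge0 => t; exact: (mt0 P).
have [Mm|Mm] := ltP 0 (M / m).
  have m_neq0 : m != 0 by apply: contraTneq Mm => ->; rewrite invr0 mulr0 ltxx.
  have [c fc] := convex_support cf Mm.
  (* This is the supporting line at the mean density [M / m] of the cell. *)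
  exists (f (M / m) - c * (M / m)), c; split; first by field.
  move=> t wt; apply: nearW => x _; have [_ g0 _] := gP t wt.
  by have := fc _ (g0 x); lra.
have M_or_m : (M == 0) || (m == 0).
  have : M / m == 0 by rewrite eq_le Mm divr_ge0.
  by rewrite mulf_eq0 invr_eq0.
exists (f 0), 0; split.
  by case/orP: M_or_m => /eqP ->; rewrite ?mul0r ?mulr0 ?addr0// mulrC.
have fine0 (S : F -> probability X R) t : 0 < w t ->
    weighted_mass w S B = 0 -> S t (B t) = 0%E.
  move=> wt /(psumr_eq0P (mt0 S)) /(_ t erefl) /eqP.
  by rewrite mulf_eq0 (gt_eqF wt)/= fine_eq0 ?fin_num_measure// => /eqP.
move=> t wt; have gPt := gP t wt; have [mg _ Pg] := gPt.
suff PB0 : P t (B t) = 0%E.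
  apply: filterS (density_ae0 gPt (mB t) PB0) => x /[apply] ->.
  by rewrite mulr0 addr0.
case/orP: M_or_m => /eqP; first exact: fine0.
(* A [Q]-null slice is [P t]-null, since [P t] has a density with respect to [Q]. *)
move=> /(fine0 (fun=> Q) t wt) QB0.
rewrite Pg// null_set_integral//; exact/measurable_funTS/measurable_EFinP.
Qed.

(** If some [P t] of positive weight is not dominated by [Q], the right-hand side is [+oo].
    Otherwise the affine coefficients on each cell are common to all [t], so the [w]-weighted sum of
    the individual bounds is exactly the left-hand side. *)
Lemma sum_fdiv_ge (A : F -> set X) : (forall t, measurable (A t)) ->
  ((weighted_mass w (fun=> Q) A
      * f (weighted_mass w P A / weighted_mass w (fun=> Q) A)
    + weighted_mass w (fun=> Q) (fun t => ~` A t)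
      * f (weighted_mass w P (fun t => ~` A t)
           / weighted_mass w (fun=> Q) (fun t => ~` A t)))%:E
    <= \sum_t (w t)%:E * fdiv f (P t) Q)%E.
Proof.
move=> mA.
have [dom|] := pselect (forall t, 0 < w t -> P t `<< Q); last first.
  move=> /existsNP[t /not_implyP[wt nPQ]].
  suff -> : (\sum_t (w t)%:E * fdiv f (P t) Q = +oo)%E by rewrite leey.
  apply/eqP; rewrite esum_eqy; last first.
    move=> s _; rewrite gt_eqF//.
    have := w0 s; rewrite le_eqVlt => /predU1P[<-|ws]; first by rewrite mul0e.
    case: (fdiv f (P s) Q) (fdiv_gtNy (P s) Q cf) => [v| |]// _.
      by rewrite -EFinM ltNyr.
    by rewrite gt0_muley ?lte_fin.
  apply/existsP; exists t => /=.
  by rewrite /fdiv asboolF// gt0_muley ?lte_fin.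
have /choice[g gP] : forall t, exists g, 0 < w t -> is_density Q g (P t) /\
    fdiv f (P t) Q = (\int[Q]_x (f (g x))%:E)%E.
  (* Indices of weight zero get a dummy function; their terms vanish even if the divergence is
     [+oo]. *)
  move=> t; have [wt|_] := ltP 0 (w t); last by exists (cst 0).
  by have [g gP fE] := fdiv_density (dom t wt); exists g; split.
have gd t : 0 < w t -> is_density Q (g t) (P t) by move=> /gP[].
have [a1 [c1 [E1 H1]]] := cell_support gd mA.
have mAC t : measurable (~` A t) by exact: measurableC.
have [a2 [c2 [E2 H2]]] := cell_support gd mAC.
rewrite -E1 -E2 /weighted_mass !mulr_sumr -!big_split/= -sumEFin.
apply: lee_sum => t _.
have := w0 t; rewrite le_eqVlt => /predU1P[<-|wt].
  by rewrite !mul0r !mulr0 !addr0 mul0e.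
have [_ ->] := gP t wt.
have wt0 : (0 <= (w t)%:E)%E by rewrite lee_fin.
apply: le_trans (lee_wpmul2l wt0 (piecewise_affine_le_integral (gd t wt) (mA t)
  cf (H1 t wt) (H2 t wt))).
by rewrite -EFinM lee_fin; lra.
Qed.

End two_cell_jensen.

(** * Bayes rules: optimality and measurable selection *)

Section testing.
Context {d : measure_display} {X : measurableType d} {R : realType}.
Context {F : finType}.
Implicit Types (w : F -> R) (P : F -> probability X R) (T : X -> F).

Lemma measure_fibers (mu : {measure set X -> \bar R}) T (A : set X) :
  is_estimator T -> measurable A ->
  (mu A = \sum_s mu (A `&` T @^-1` [set s]))%E.
Proof.
move=> mT mA; rewrite (bigfs _ (index_enum_uniq F))/=; last first.
  by move=> s _; rewrite mem_index_enum.
rewrite -measure_fin_bigcup; last first.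
- by move=> s _; exact: measurableI.
- exact: trivIset_preimage1_in.
- exact: finite_finset.
congr (mu _); apply/seteqP; split => [x Ax|x [s _ []]//].
by exists (T x).
Qed.

Lemma probability_fibers (S : probability X R) T (A : set X) :
  is_estimator T -> measurable A ->
  fine (S A) = \sum_s fine (S (A `&` T @^-1` [set s])).
Proof.
move=> mT mA; rewrite (measure_fibers S mT mA) -sum_fine// => s _.
by rewrite fin_num_measure//; exact: measurableI.
Qed.

(** The function [w \o T] is a finite combination of indicators of the fibers of [T]. *)
Lemma Rintegral_estimator (Q : probability X R) w T :
  (forall t, 0 <= w t) -> is_estimator T ->
  \int[Q]_x w (T x) = weighted_mass w (fun=> Q) (fun t => T @^-1` [set t]).
Proof.
move=> w0 mT; rewrite /Rintegral /weighted_mass.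
under eq_integral => x _.
  rewrite (_ : w (T x) = \sum_t w t * \1_(T @^-1` [set t]) x); last first.
    rewrite (bigD1 (T x))//= indicE mem_set// mulr1 big1 ?addr0// => t tT.
    by rewrite indicE memNset ?mulr0//= => /eqP; rewrite eq_sym (negbTE tT).
  rewrite -sumEFin; over.
rewrite ge0_integral_sum//; last 2 first.
- move=> t; apply/measurable_EFinP/measurable_funM => //.
- by move=> t x _; rewrite lee_fin mulr_ge0.
rewrite (eq_bigr (fun t => (w t * fine (Q (T @^-1` [set t])))%:E)) ?sumEFin//.
move=> t _; under eq_integral do rewrite EFinM.
rewrite ge0_integralZl_EFin//; last first.
  by apply/measurable_EFinP; exact: measurable_indic.
by rewrite integral_indic// setIT EFinM fineK// fin_num_measure.
Qed.

Lemma weighted_massC w (P : F -> probability X R) (A : F -> set X) :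
  \sum_t w t = 1 -> (forall t, measurable (A t)) ->
  weighted_mass w P (fun t => ~` A t) = 1 - weighted_mass w P A.
Proof.
move=> w1 mA; rewrite -w1 -sumrB; apply: eq_bigr => t _.
rewrite probability_setC// fineB ?fin_num_measure//=.
by rewrite mulrBr mulr1.
Qed.

Variables (mu : {measure set X -> \bar R}).
Variables (P : F -> probability X R) (p : F -> X -> R).
Hypothesis hp : forall t, is_density mu (p t) (P t).

(** Both success masses are split over the common refinement by the fibers of [T] and [T']. Where
    [T' = t] and [T = s], the summands are the integrals of [w t * p t] and [w s * p s], which the
    argmax property orders pointwise. *)
Lemma argmax_success_max w T T' :
  (forall t, 0 <= w t) -> is_argmax w p T -> is_estimator T -> is_estimator T' ->
  weighted_mass w P (fun t => T' @^-1` [set t]) <=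
  weighted_mass w P (fun t => T @^-1` [set t]).
Proof.
move=> w0 wT mT mT'; rewrite /weighted_mass.
under eq_bigr => t _ do rewrite (probability_fibers _ mT (mT' _)) mulr_sumr.
under [leRHS]eq_bigr => t _ do
  rewrite (probability_fibers _ mT' (mT _)) mulr_sumr.
rewrite [leRHS]exchange_big/=; apply: ler_sum => t _; apply: ler_sum => s _.
rewrite [X in _ <= w s * fine (P s X)]setIC.
set B := _ `&` _; have mB : measurable B by exact: measurableI.
have ip u : mu.-integrable B (EFin \o p u).
  exact: integrableS (density_integrable (hp u)).
have iwp u : mu.-integrable B (fun x => (w u * p u x)%:E).
  have -> : (fun x => (w u * p u x)%:E) = (fun x => ((w u)%:E * (p u x)%:E)%E) by [].
  by apply: integrableZl => //; exact: ip.
have IE u : w u * fine (P u B) = \int[mu]_(x in B) (w u * p u x).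
  by rewrite RintegralZl// (density_fine (hp u)).
rewrite !IE; apply: le_Rintegral => //; [exact: iwp|exact: iwp|].
by move=> x [_ /= <-]; exact: wT.
Qed.

Lemma bayes_risk_argmax w T : is_pmf w -> is_estimator T -> is_argmax w p T ->
  bayes_risk P w = testing_risk P w T.
Proof.
move=> [w0 w1] mT wT.
have lb : lbound [set testing_risk P w T' | T' in [set T' | is_estimator T']]
    (testing_risk P w T).
  move=> _ [T' mT' <-].
  rewrite [leLHS](@weighted_massC w P (fun t => T @^-1` [set t]))//.
  rewrite [leRHS](@weighted_massC w P (fun t => T' @^-1` [set t]))//.
  by rewrite lerD2l lerN2 argmax_success_max.
apply/le_anti/andP; split.
- by apply: ge_inf; [eexists; exact: lb|exists T].
- by apply: lb_le_inf => //; eexists; exists T.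
Qed.

(** Needed for the uniform prior, where no rule is given. The selected point depends on [x] only
    through the finite set [S x] of maximizers, so measurability reduces to that of the events
    [S x = C]. *)
Lemma argmax_exists w : (0 < #|F|)%N ->
  exists2 T : X -> F, is_estimator T & is_argmax w p T.
Proof.
move=> /card_gt0P[t0 _]; have mp u : measurable_fun setT (p u) by have [] := hp u.
pose S x := [set s | [forall t, w t * p t x <= w s * p s x]]%SET.
exists (fun x => odflt t0 [pick s in S x]) => [B|x t]; last first.
  case: pickP => [s|noS] /=; first by rewrite inE => /forallP; exact.
  (* A maximum over a finite set is attained, so [S x] is nonempty and the default [t0] is never
     returned. *)
  have := noS [arg max_(s > t0) (w s * p s x)]%O.
  case: arg_maxP => //= s _ smax /negP; case.
  by rewrite inE; apply/forallP => u; exact: smax.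
rewrite (_ : _ @^-1` _ =
    \bigcup_(C in [set C : {set F} | B (odflt t0 [pick s in C])]) S @^-1` [set C]).
  apply: fin_bigcup_measurable => [|C _]; first exact: finite_finset.
  (* The event [S x = C] is decided by the membership of each [s], itself a finite conjunction of
     comparisons of measurable functions. *)
  rewrite (_ : _ @^-1` _ = \bigcap_(s in [set: F])
    (if s \in C then S @^-1` [set D : {set F} | s \in D]
     else ~` (S @^-1` [set D : {set F} | s \in D]))); last first.
    apply/seteqP; split => [x /= <- s _|x /= CS]; first by case: ifPn => // /negP.
    apply/setP => s; have := CS s I.
    by case: (s \in C) => /= [->//|/negP/negbTE].
  apply: fin_bigcap_measurable => [|s _]; first exact: finite_finset.
  have mS : measurable (S @^-1` [set D : {set F} | s \in D]).
    rewrite (_ : _ @^-1` _ =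
      \bigcap_(t in [set: F]) [set x | w t * p t x <= w s * p s x]).
      apply: fin_bigcap_measurable => [|t _]; first exact: finite_finset.
      rewrite -[X in measurable X]setTI; apply: measurable_fun_le => //;
        exact: measurable_funM.
    apply/seteqP; split => [x /=|x /= px].
      by rewrite inE => /forallP px t _; exact: px.
    by rewrite inE; apply/forallP => t; exact: px.
  by case: ifP => // _; exact: measurableC.
apply/seteqP; split => [x /= Bx|x [C /= BC SC]]; first by exists (S x).
by rewrite /= SC.
Qed.

End testing.

(* Division by 0 yields 0 in [R], so [W * f (a / W)] is 0 when [W = 0], and
   [(1 - W) * f (b / (1 - W))] is 0 when [W = 1]; in [\bar R], 0 * +oo = 0. *)
Theorem mainTheorem1 (R : realType) (d : measure_display)
    (X : measurableType d) (F : finType) (hF : (2 <= #|F|)%N)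
    (mu : {sigma_finite_measure set X -> \bar R})
    (P : F -> probability X R) (p : F -> X -> R)
    (hp : forall t, is_density mu (p t) (P t)) :
  (forall (w : F -> R) (T : X -> F),
     is_pmf w -> is_estimator T -> is_argmax w p T ->
     forall (f : R -> R) (Q : probability X R),
       convex_function (`[0, +oo[%classic : set R) f ->
       let r := bayes_risk P w in
       let W := \int[Q]_x w (T x) in
       ((W * f ((1 - r) / W) + (1 - W) * f (r / (1 - W)))%:E
         <= \sum_(t : F) (w t)%:E * fdiv f (P t) Q)%E)
  /\
  (forall (f : R -> R) (Q : probability X R),
     convex_function (`[0, +oo[%classic : set R) f ->
     let N : R := #|F|%:R in
     let r := bayes_risk P (fun=> N^-1) in
     ((f (N * (1 - r)) + (N - 1) * f (N * r / (N - 1)))%:E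
       <= \sum_(t : F) fdiv f (P t) Q)%E).
Proof.
have part1 (w : F -> R) (T : X -> F) : is_pmf w -> is_estimator T ->
    is_argmax w p T -> forall (f : R -> R) (Q : probability X R),
    convex_function (`[0, +oo[%classic : set R) f ->
    let r := bayes_risk P w in let W := \int[Q]_x w (T x) in
    ((W * f ((1 - r) / W) + (1 - W) * f (r / (1 - W)))%:E
      <= \sum_(t : F) (w t)%:E * fdiv f (P t) Q)%E.
  move=> wF mT wT f Q cf /=; have [w0 w1] := wF.
  set r := bayes_risk P w; set W := Rintegral _ _ _.
  have := sum_fdiv_ge P Q w0 cf (fun t => mT [set t]).
  rewrite (weighted_massC (fun=> Q) w1)//.
  rewrite (weighted_massC P w1 (fun t => mT [set t])) -Rintegral_estimator// -/W.
  (* The success mass of [T] is the complement of its risk, which is the Bayes risk. *)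
  suff -> : weighted_mass w P (fun t => T @^-1` [set t]) = 1 - r.
    by rewrite subKr.
  rewrite /r (bayes_risk_argmax hp wF mT wT).
  by rewrite -[testing_risk P w T]/(weighted_mass w P (fun t => ~` (T @^-1` [set t])))
    (weighted_massC P w1 (fun t => mT [set t])) subKr.
split=> // f Q cf /=; set N := _%:R; set r := bayes_risk _ _.
have N2 : 2 <= N by rewrite /N ler_nat.
have N0 : 0 < N by lra.
have pmfN : is_pmf (fun _ : F => N^-1).
  split=> [i|]; first by rewrite invr_ge0 ltW.
  by rewrite sumr_const -[LHS]mulr_natl mulfV ?gt_eqF.
have [T mT wT] := argmax_exists hp (fun=> N^-1) (ltnW hF).
have := part1 _ T pmfN mT wT f Q cf.
(* Under the uniform prior [W] equals [1 / N], whatever [T] and [Q] are. *)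
have -> : \int[Q]_x N^-1 = N^-1 :> R.
  rewrite Rintegral_cst// [X in fine X](_ : _ = 1%E) ?mulr1//.
  exact: probability_setT.
rewrite /= -/r.
(* Factoring [1 / N] out of an extended sum requires that [+oo] and [-oo] never meet. *)
rewrite -fin_num_sume_distrr//; last first.
  by move=> i j _ _; apply: ltninfty_adde_def; rewrite inE fdiv_gtNy.
rewrite lee_pdivlMl// -EFinM; apply: le_trans; rewrite lee_fin.
rewrite invrK [(1 - r) * N]mulrC.
have -> : r / (1 - N^-1) = N * r / (N - 1) by field; lra.
have NE : N * (1 - N^-1) = N - 1 by rewrite mulrBr mulr1 mulfV ?gt_eqF.
by rewrite [leRHS]mulrDr mulVKf ?gt_eqF// [N * (_ * _)]mulrA NE.
Qed.
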